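(* Suppose Assumption (G) holds. Let $(f^n)_n$ in $Y$ and $f^\dagger\in Y$ be such that $f^n\overset{D}{\to}f^\dagger$ as $n\to\infty$, and take $\lambda^\dagger\in(0,\infty)^N$. Assume that for some solution $u_0$ of $\min_{u\in\operatorname{dom}(T)}J_{\lambda^\dagger}(u,f^\dagger)$ with $J_{\lambda^\dagger}(u_0,f^\dagger)<\infty$, condition $S_1(u_0,f^\dagger,\{1,\dots,N\})$ holds. Then every sequence $(u^n)_n$ of solutions to $$\min_{u\in\operatorname{dom}(T)}J_{\lambda^\dagger}(u,f^n)$$ admits a $\tau_X$-convergent subsequence, again denoted by $(u^n)_n$, with limit $u^\dagger$ such that $$\lim_{n\to\infty}D_i(T_iu^n,f_i^n)=D_i(T_iu^\dagger,f_i^\dagger)\quad\text{for all }i,\qquad \lim_{n\to\infty}R(u^n)=R(u^\dagger),$$ and every limit of a $\tau_X$-convergent subsequence of solutions is a solution to $$\min_{u\in\operatorname{dom}(T)}J_{\lambda^\dagger}(u,f^\dagger).$$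
   Context: Setting. Let $(X,\|\cdot\|_X)$ be a Banach space and $R\colon X\to[0,\infty]$. For $i=1,\dots,N$ let $(Y_i,\|\cdot\|_{Y_i})$ be a normed space, $D_i\colon Y_i\times Y_i\to[0,\infty]$ a data discrepancy and $T_i\colon \operatorname{dom}(T_i)\subset X\to Y_i$ an operator. Put $\operatorname{dom}(T)=\bigcap_{i=1}^N\operatorname{dom}(T_i)$ and $Y=Y_1\times\cdots\times Y_N$. For $u\in\operatorname{dom}(T)$, $f\in Y$ and $\lambda\in(0,\infty)^N$ let $$J_\lambda(u,f)=\sum_{i=1}^N\lambda_iD_i(T_iu,f_i)+R(u).$$ Let $\tau_X$ be a Hausdorff topology on $X$, and for each $i$ let $\tau_{Y_i}$ (Hausdorff) and $\tau_{D_i}$ (arbitrary) be topologies on $Y_i$. Write $f_i^n\overset{D_i}{\to}f_i$ if $D_i(f_i,f_i^n)\to0$ and $f_i^n\to f_i$ in $\tau_{D_i}$ as $n\to\infty$; $f^n\overset{D}{\to}f$ means this holds for every component. Assumption (G): (1) For each $i$ and $a,b\in Y_i$, $D_i(a,b)=0$ implies $a=b$. (2) For each $i$: if $a^n\to a$ in $\tau_{Y_i}$ and $f_i^n\overset{D_i}{\to}f_i$, then $D_i(a,f_i)\le\liminf_{n\to\infty}D_i(a^n,f_i^n)$. (3) $R$ is lower semi-continuous w.r.t. $\tau_X$. (4) Each $T_i$ is continuous from $(X,\tau_X)$ (on $\operatorname{dom}(T_i)$) to $(Y_i,\tau_{Y_i})$ and $\operatorname{dom}(T_i)$ is closed w.r.t.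 convergence in $\tau_X$. (5) For any $\lambda\in(0,\infty)^N$: whenever $f^n\overset{D}{\to}f$ and $J_\lambda(u^n,f^n)<c$ for all $n$ and some constant $c$, the sequence $(u^n)_n$ admits a $\tau_X$-convergent subsequence. Condition $S_1(u,f^\dagger,\{1,\dots,N\})$: for each $i\in\{1,\dots,N\}$ the map $f_i\mapsto D_i(T_iu,f_i)$ is continuous at $f_i^\dagger$ w.r.t. $D_i$-convergence, i.e. $f_i^n\overset{D_i}{\to}f_i^\dagger$ implies $D_i(T_iu,f_i^n)\to D_i(T_iu,f_i^\dagger)$. *)

(* Defs.v *)
From HB Require Import structures.
From mathcomp Require Import all_boot all_order all_algebra.
From mathcomp Require Import all_classical all_reals all_analysis.
Set Implicit Arguments.
Unset Strict Implicit.
Unset Printing Implicit Defensive.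
Import Order.TTheory GRing.Theory Num.Theory.
Import numFieldNormedType.Exports.
Local Open Scope classical_set_scope.
Local Open Scope ring_scope.
Local Open Scope ereal_scope.

(* A topology on a carrier that may already carry another one (such as the
   norm topology).  [with_topology tau] has carrier convertible to [T], and its
   topology is [tau], whatever canonical topology [T] has.  To keep canonical
   structure inference from selecting the norm topology, the topological
   notions below are first stated for an abstract [topologicalType] and only
   then instantiated with [with_topology tau]. *)
Definition topology_on (T : Type) : Type := Topological T.

Definition with_topology (T : Type) (tau : topology_on T) : topologicalType :=
  Topological.Pack tau.

Definition seq_cvg (T : topologicalType) (x : nat -> T) (l : T) : Prop :=
  x n @[n --> \oo] --> l.

Definition continuous_on (S T : topologicalType) (A : set S) (f : S -> T) :
    Prop :=
  {within A, continuous f}.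

Definition cvg_in (T : Type) (tau : topology_on T) (x : nat -> T) (l : T) :
    Prop :=
  @seq_cvg (with_topology tau) x l.

Definition is_argmin (R : realType) (X : Type) (A : set X) (F : X -> \bar R)
    (u : X) : Prop :=
  A u /\ forall v, A v -> F u <= F v.

Section Setting.
Context {K : numFieldType} {R : realType}.
Context {X : completeNormedModType K}.
Context {N : nat} {Y : 'I_N -> normedModType K}.

(* The partial operator T_i is the pair of the set [domT i] and the total
   function [T i], whose values outside [domT i] are irrelevant. *)
Variables (Reg : X -> \bar R) (D : forall i, Y i -> Y i -> \bar R).
Variables (domT : 'I_N -> set X) (T : forall i, X -> Y i).
Variables (tauX : topology_on X).
Variables (tauY tauD : forall i, topology_on (Y i)).

Definition dom_all : set X := [set u | forall i, domT i u].

Definition J (lambda : 'I_N -> R) (u : X) (f : forall i, Y i) : \bar R :=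
  \sum_(i < N) (lambda i)%:E * D (T i u) (f i) + Reg u.

Definition D_cvg1 (i : 'I_N) (g : nat -> Y i) (g0 : Y i) : Prop :=
  D g0 (g n) @[n --> \oo] --> 0 /\ cvg_in (tauD i) g g0.

Definition D_cvg (f : nat -> forall i, Y i) (f0 : forall i, Y i) : Prop :=
  forall i, D_cvg1 (fun n => f n i) (f0 i).

Record assumption_G : Prop := AssumptionG {
  G_separation : forall i (a b : Y i), D a b = 0 -> a = b;
  G_lsc_D : forall i (a : nat -> Y i) (a0 : Y i) (g : nat -> Y i) (g0 : Y i),
    cvg_in (tauY i) a a0 -> D_cvg1 g g0 ->
    D a0 g0 <= limn_einf (fun n => D (a n) (g n));
  G_lsc_Reg : @lower_semicontinuous (with_topology tauX) R Reg;
  G_continuous_T : forall i,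
    @continuous_on (with_topology tauX) (with_topology (tauY i))
      (domT i) (T i);
  G_closed_dom : forall i (u : nat -> X) (u0 : X),
    (forall n, domT i (u n)) -> cvg_in tauX u u0 -> domT i u0;
  G_compact : forall (lambda : 'I_N -> R), (forall i, (0 < lambda i)%R) ->
    forall (f : nat -> forall i, Y i) (f0 : forall i, Y i)
           (u : nat -> X) (c : R),
    D_cvg f f0 ->
    (forall n, dom_all (u n)) ->
    (forall n, J lambda (u n) (f n) < c%:E) ->
    exists (phi : nat -> nat) (u0 : X),
      increasing_seq phi /\ cvg_in tauX (fun n => u (phi n)) u0 }.

Definition S1 (u : X) (f0 : forall i, Y i) (I : set 'I_N) : Prop :=
  forall i, I i -> forall g : nat -> Y i,
    D_cvg1 g (f0 i) -> D (T i u) (g n) @[n --> \oo] --> D (T i u) (f0 i).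

Definition solution (lambda : 'I_N -> R) (f : forall i, Y i) (u : X) : Prop :=
  is_argmin dom_all (fun v => J lambda v f) u.

End Setting.

(* Main.v *)
Require Import Defs.
From HB Require Import structures.
From mathcomp Require Import all_boot all_order all_algebra.
From mathcomp Require Import all_classical all_reals all_analysis.
From mathcomp Require Import lra.
Set Implicit Arguments.
Unset Strict Implicit.
Unset Printing Implicit Defensive.
Import Order.TTheory GRing.Theory Num.Theory.
Import numFieldNormedType.Exports.
Local Open Scope classical_set_scope.
Local Open Scope ring_scope.
Local Open Scope ereal_scope.

(** Convergence of values under stable minimisation.

    Along any convergent sequence of minimisers [w n] for data [g n] tending to
    [fdag], with limit [v], every summand of the functional is lower
    semicontinuous, so the limit value of [J v fdag] is asymptotically below
    [J (w n) (g n)].  Minimality compares [J (w n) (g n)] with [J u0 (g n)],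
    and condition S1 makes the latter tend to [J u0 fdag], which is the finite
    minimal value for [fdag].  Hence [v] is a minimiser for [fdag].

    Since [J v fdag] is then equal to the limit of these upper bounds, no
    summand has room to stay above its limit value: if one did, the others
    would have to fall below theirs, against lower semicontinuity
    ([cvge_of_add_squeeze]).  So each discrepancy and the penalty converge
    separately; finiteness of the limit value is what allows the subtraction.
    This is [cvg_solutions], and it applies to every convergent subsequence.

    A convergent subsequence exists because [J u0 (f n)] has a finite limit,
    hence is bounded from some rank on, so the compactness assumption applies
    to a tail of the sequence of minimisers.

    The inequality [A <= liminf a] is handled through the equivalent condition
    [liminf_ge] on real numbers below [A], which has the same form as lower
    semicontinuity and adds up over nonnegative summands even when some
    limit values are infinite. *)

(** * Asymptotic lower bounds for extended real sequences *)

Section LiminfGe.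
Context {R : realType}.
Implicit Types (a b c : nat -> \bar R) (A B C : \bar R).

Lemma exists_real_between A B :
  A < B -> exists2 r : R, A < r%:E & r%:E < B.
Proof.
case: A B => [x| |] [y| |] // AB.
- have xy : (x < y)%R by [].
  by exists ((x + y) / 2)%R; rewrite lte_fin; lra.
- by exists (x + 1)%R; rewrite ?ltry// lte_fin; lra.
- by exists (y - 1)%R; rewrite ?ltNyr// lte_fin; lra.
- by exists 0%R; rewrite ?ltNyr ?ltry.
Qed.

Definition liminf_ge a A : Prop :=
  forall r : R, r%:E < A -> \forall n \near \oo, r%:E < a n.

Lemma liminf_ge_limn_einf a A : A <= limn_einf a -> liminf_ge a A.
Proof.
move=> Aa r rA; have {A rA Aa} := lt_le_trans rA Aa.
rewrite limn_einf_lim => ra.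
have [m rm] : exists m, r%:E < einfs a m.
  apply: contrapT => /forallNP ar; move: ra; apply/negP; rewrite -leNgt.
  apply: lime_le; first exact: is_cvg_einfs.
  by apply: nearW => m; rewrite leNgt; apply/negP/ar.
near=> n; apply: (lt_le_trans rm); apply: ereal_inf_lbound; exists n => //=.
by near: n; exact: nbhs_infty_ge.
Unshelve. all: by end_near. Qed.

Lemma liminf_ge_cvg_le a c A C :
  liminf_ge a A -> c n @[n --> \oo] --> C -> (forall n, a n <= c n) -> A <= C.
Proof.
move=> aA cC ac; rewrite leNgt; apply/negP => CA.
have [r Cr rA] := exists_real_between CA.
have : C <= r%:E by exact: ltW.
have : r%:E <= C.
  rewrite -(cvg_lim _ cC)//; apply: lime_ge; first by apply/cvg_ex; exists C.
  near=> n; apply: (le_trans _ (ac n)); apply: ltW; near: n; exact: aA.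
by move=> /le_lt_trans/(_ Cr); rewrite ltxx.
Unshelve. all: by end_near. Qed.

Lemma liminf_geZ (k : R) a A : (0 < k)%R ->
  liminf_ge a A -> liminf_ge (fun n => k%:E * a n) (k%:E * A).
Proof.
move=> k0 aA r; rewrite -lte_pdivrMl// -EFinM => /aA.
by apply: filterS => n; rewrite EFinM lte_pdivrMl.
Qed.

(** Nonnegativity excludes sums of the form [+oo - oo], so that a real number
    below the sum splits into real numbers below each summand. *)
Lemma liminf_geD a b A B : 0 <= A -> 0 <= B ->
  liminf_ge a A -> liminf_ge b B -> liminf_ge (fun n => a n + b n) (A + B).
Proof.
move=> A0 B0 aA bB r rAB.
have [p [q [pA qB rpq]]] :
    exists p q : R, [/\ p%:E < A, q%:E < B & (r <= p + q)%R].
  case: A B A0 B0 rAB {aA bB} => [x| |] [y| |] // x0 y0 rAB.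
  - rewrite -EFinD lte_fin in rAB.
    exists (x - (x + y - r) / 2)%R, (y - (x + y - r) / 2)%R.
    by rewrite !lte_fin; split; lra.
  - by exists (x - 1)%R, (r - x + 1)%R; rewrite ltry lte_fin; split=> //; lra.
  - by exists (r - y + 1)%R, (y - 1)%R; rewrite ltry lte_fin; split=> //; lra.
  - by exists r, 0%R; rewrite !ltry; split=> //; lra.
apply: filterS2 (aA _ pA) (bB _ qB) => n pa qb.
apply: (@le_lt_trans _ _ (p%:E + q%:E)); first by rewrite -EFinD lee_fin.
exact: lteD.
Qed.

Lemma liminf_ge_sum (I : Type) (s : seq I) (P : pred I)
    (a : I -> nat -> \bar R) (A : I -> \bar R) :
  (forall i, 0 <= A i) -> (forall i, liminf_ge (a i) (A i)) ->
  liminf_ge (fun n => \sum_(i <- s | P i) a i n) (\sum_(i <- s | P i) A i).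
Proof.
move=> A0 aA; elim: s => [|i s IH].
  by rewrite big_nil => r r0; apply: nearW => n; rewrite big_nil.
rewrite big_cons.
under [X in liminf_ge X]eq_fun do rewrite big_cons.
by case: (P i) => //; apply: liminf_geD => //; exact: sume_ge0.
Qed.

(** The upper bound on [a] comes from subtracting the asymptotic lower bound
    of [b] from that of the sum, which requires finite limit values. *)
Lemma cvge_of_add_squeeze a b c A B : 0 <= A -> 0 <= B -> A + B < +oo ->
  liminf_ge a A -> liminf_ge b B ->
  (forall n, a n + b n <= c n) -> c n @[n --> \oo] --> A + B ->
  a n @[n --> \oo] --> A.
Proof.
case: A B => [x| |] [y| |] // x0 y0 _ aA bB abc cAB.
have close (e : R) : (0 < e)%R ->
    \forall n \near \oo, (x - e)%:E < a n /\ a n < (x + e)%:E.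
  move=> e0.
  have a_gt : \forall n \near \oo, (x - e)%:E < a n.
    by apply: aA; rewrite lte_fin; lra.
  have b_gt : \forall n \near \oo, (y - e / 2)%:E < b n.
    by apply: bB; rewrite lte_fin; lra.
  have c_lt : \forall n \near \oo, c n < (x + y + e / 2)%:E.
    apply: (cAB [set z | z < (x + y + e / 2)%:E]).
    by apply: open_ereal_lt'; rewrite -EFinD lte_fin; lra.
  near=> n; split; first by near: n.
  have bn : (y - e / 2)%:E < b n by near: n.
  have cn : c n < (x + y + e / 2)%:E by near: n.
  have an : (x - e)%:E < a n by near: n.
  have := le_lt_trans (abc n) cn.
  case: (a n) (b n) an bn => [p| |] [q| |] //=; rewrite -?EFinD ?lte_fin//.
  by move=> ? ? ?; lra.
apply/fine_cvgP; split.
  apply: filterS (close 1%R ltr01) => n [].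
  by case: (a n) => // p _ _.
apply/cvgrPdist_lt => e e0; apply: filterS (close e e0) => n [] /=.
case: (a n) => [p| |] //=; rewrite !lte_fin => h1 h2.
by rewrite ltr_norml; lra.
Unshelve. all: by end_near. Qed.

End LiminfGe.

(** * Sequential consequences of the topological hypotheses *)

Lemma liminf_ge_lower_semicontinuous (R : realType) (S : topologicalType)
    (h : S -> \bar R) (x : nat -> S) (l : S) :
  lower_semicontinuous h -> seq_cvg x l -> liminf_ge (fun n => h (x n)) (h l).
Proof.
move=> lsc xl r /lsc[V lV Vh].
have : \forall n \near \oo, V (x n) by exact: xl.
by apply: filterS => n /Vh.
Qed.

Lemma seq_cvg_continuous_on (S U : topologicalType) (A : set S) (h : S -> U)
    (x : nat -> S) (l : S) :
  continuous_on A h -> (forall n, A (x n)) -> A l ->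
  seq_cvg x l -> seq_cvg (fun n => h (x n)) (h l).
Proof.
move=> hA xA lA xl V /(hA l).
rewrite /= /nbhs/= -nbhs_subspace_in// => /xl.
by rewrite /= /nbhs/=; apply: filterS => n; apply.
Qed.

Lemma increasing_seq_cvgny (phi : nat -> nat) :
  increasing_seq phi -> phi n @[n --> \oo] --> \oo.
Proof.
move=> phi_inc.
have phi_ge n : (n <= phi n)%N.
  elim: n => // n IH; apply: (leq_ltn_trans IH).
  by have := leW_mono phi_inc n n.+1; rewrite !ltEnat/= ltnSn.
move=> V [m _ mV]; exists m => // n mn; apply: mV => /=.
exact: leq_trans mn (phi_ge n).
Qed.

(** * Limits of minimisers *)

Section Stability.
Context {K : numFieldType} {R : realType}.
Context {X : completeNormedModType K}.
Context {N : nat} {Y : 'I_N -> normedModType K}.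
Variables (Reg : X -> \bar R) (D : forall i, Y i -> Y i -> \bar R).
Variables (domT : 'I_N -> set X) (T : forall i, X -> Y i).
Variables (tauX : topology_on X).
Variables (tauY tauD : forall i, topology_on (Y i)).
Hypothesis Reg_ge0 : forall u, 0 <= Reg u.
Hypothesis D_ge0 : forall i (a b : Y i), 0 <= D a b.
Variable lambda : 'I_N -> R.
Hypothesis lambda_gt0 : forall i, (0 < lambda i)%R.

Let wD i (u : X) (f : forall i, Y i) : \bar R :=
  (lambda i)%:E * D (T i u) (f i).

Let wD_ge0 i u f : 0 <= wD i u f.
Proof. by rewrite mule_ge0// lee_fin ltW. Qed.

Let JE u f : J Reg D T lambda u f = \sum_(i < N) wD i u f + Reg u.
Proof. by []. Qed.

Lemma D_cvg_subseq (f : nat -> forall i, Y i) f0 (phi : nat -> nat) :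
  increasing_seq phi -> D_cvg D tauD f f0 -> D_cvg D tauD (f \o phi) f0.
Proof.
move=> /increasing_seq_cvgny phiy ff i; have [Df tf] := ff i.
split; first exact: cvg_comp phiy Df.
by move=> V /tf; exact: phiy.
Qed.

Lemma cvg_J_data (u0 : X) (f0 : forall i, Y i) (g : nat -> forall i, Y i) :
  S1 D T tauD u0 f0 setT -> D_cvg D tauD g f0 ->
  J Reg D T lambda u0 f0 < +oo ->
  J Reg D T lambda u0 (g n) @[n --> \oo] --> J Reg D T lambda u0 f0.
Proof.
move=> S1u gf Jfin.
have sum_ge0 : 0 <= \sum_(i < N) wD i u0 f0 by exact: sume_ge0.
apply: cvgeD.
- by rewrite ge0_adde_def ?inE.
- apply: cvg_nnesum => i _; first by apply: nearW => n; exact: wD_ge0.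
  by apply: cvgeZl => //; apply: S1u => //; exact: gf.
- exact: cvg_cst.
Qed.

Hypothesis HG : assumption_G Reg D domT T tauX tauY tauD.

(** A squeeze between lower semicontinuity of the summands at [v] and the
    comparison values [J u0 (g n)].  It first identifies [J v f0] with
    [J u0 f0], so that the limit of the comparison values is the sum of the
    limit values at [v]; each summand is then played against the rest. *)
Lemma cvg_solutions (u0 v : X) (f0 : forall i, Y i)
    (g : nat -> forall i, Y i) (w : nat -> X) :
  solution Reg D domT T lambda f0 u0 -> J Reg D T lambda u0 f0 < +oo ->
  S1 D T tauD u0 f0 setT -> D_cvg D tauD g f0 ->
  (forall n, solution Reg D domT T lambda (g n) (w n)) ->
  cvg_in tauX w v ->
  [/\ solution Reg D domT T lambda f0 v,
      forall i, D (T i (w n)) (g n i) @[n --> \oo] --> D (T i v) (f0 i)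
    & Reg (w n) @[n --> \oo] --> Reg v].
Proof.
move=> [u0dom u0min] u0fin u0S1 gf wsol wv.
have wdom n i : domT i (w n) by have [wd _] := wsol n; exact: wd.
have vdom i : domT i v by apply: (G_closed_dom HG (wdom^~ i) wv).
have lscD i : liminf_ge (fun n => D (T i (w n)) (g n i)) (D (T i v) (f0 i)).
  have Tcvg : cvg_in (tauY i) (fun n => T i (w n)) (T i v).
    exact: (@seq_cvg_continuous_on (with_topology tauX) (with_topology (tauY i))
      _ _ _ _ (G_continuous_T HG (i:=i)) (wdom^~ i) (vdom i) wv).
  exact/liminf_ge_limn_einf/(G_lsc_D HG Tcvg (gf i)).
have lscwD i : liminf_ge (fun n => wD i (w n) (g n)) (wD i v f0).
  exact: liminf_geZ.
have lscReg : liminf_ge (fun n => Reg (w n)) (Reg v).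
  exact: (liminf_ge_lower_semicontinuous (G_lsc_Reg HG) wv).
have lscJ : liminf_ge (fun n => J Reg D T lambda (w n) (g n))
                      (J Reg D T lambda v f0).
  under [X in liminf_ge X]eq_fun do rewrite JE.
  rewrite JE; apply: liminf_geD => //; first exact: sume_ge0.
  exact: liminf_ge_sum.
have Ju0 := cvg_J_data u0S1 gf u0fin.
have Jwu0 n : J Reg D T lambda (w n) (g n) <= J Reg D T lambda u0 (g n).
  by have [_ wmin] := wsol n; exact: wmin.
have Jvu0 : J Reg D T lambda v f0 = J Reg D T lambda u0 f0.
  apply/le_anti; rewrite (liminf_ge_cvg_le lscJ Ju0 Jwu0)/=.
  exact: u0min.
rewrite -Jvu0 in u0fin Ju0 u0min.
split => // [i|].
- suff wDcvg : wD i (w n) (g n) @[n --> \oo] --> wD i v f0.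
    (* Multiplying by the inverse weight recovers the bare discrepancy. *)
    have unscale x : x = ((lambda i)^-1)%:E * ((lambda i)%:E * x).
      by rewrite muleA -EFinM mulVf ?mul1e// gt_eqF.
    rewrite [X in _ --> X]unscale.
    under eq_fun do rewrite [D _ _]unscale.
    exact: cvgeZl.
  have splitJ u f : J Reg D T lambda u f =
      wD i u f + (\sum_(j < N | j != i) wD j u f + Reg u).
    by rewrite JE (bigD1 i)//= addeA.
  apply: (@cvge_of_add_squeeze _ _
    (fun n => \sum_(j < N | j != i) wD j (w n) (g n) + Reg (w n))
    (fun n => J Reg D T lambda u0 (g n)) _
    (\sum_(j < N | j != i) wD j v f0 + Reg v)) => //.
  + by rewrite adde_ge0// sume_ge0.
  + by rewrite -splitJ.
  + by apply: liminf_geD => //; [exact: sume_ge0|exact: liminf_ge_sum].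
  + by move=> n; rewrite -splitJ.
  + by rewrite -splitJ.
- apply: (@cvge_of_add_squeeze _ _ (fun n => \sum_(j < N) wD j (w n) (g n))
    (fun n => J Reg D T lambda u0 (g n)) _ (\sum_(j < N) wD j v f0)) => //.
  + exact: sume_ge0.
  + by rewrite addeC -JE.
  + exact: liminf_ge_sum.
  + by move=> n; rewrite addeC -JE.
  + by rewrite addeC -JE.
Qed.

(** The uniform bound required by the compactness assumption holds only from
    some rank on, because finitely many of the values [J u0 (f n)] may be
    infinite; hence the passage to a tail. *)
Lemma solutions_cvg_subseq (u0 : X) (f0 : forall i, Y i)
    (f : nat -> forall i, Y i) (u : nat -> X) :
  dom_all domT u0 -> J Reg D T lambda u0 f0 < +oo ->
  S1 D T tauD u0 f0 setT -> D_cvg D tauD f f0 ->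
  (forall n, solution Reg D domT T lambda (f n) (u n)) ->
  exists (phi : nat -> nat) (v : X),
    increasing_seq phi /\ cvg_in tauX (fun n => u (phi n)) v.
Proof.
move=> u0dom u0fin u0S1 ff usol.
have Ju0 := cvg_J_data u0S1 ff u0fin.
have [c Jc] : exists c : R, J Reg D T lambda u0 f0 < c%:E.
  case: (J _ _ _ _ _ _) u0fin => [x| |] // _.
  - by exists (x + 1)%R; rewrite lte_fin; lra.
  - by exists 0%R; rewrite ltNyr.
have [m _ Jm] : \forall n \near \oo, J Reg D T lambda u0 (f n) < c%:E.
  by apply: (Ju0 [set z | z < c%:E]); exact: open_ereal_lt'.
have shift_inc : increasing_seq (addn m) by move=> x y; exact: leq_add2l.
have [n|n|phi [v [phi_inc uv]]] := G_compact HG lambda_gt0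
  (u := fun n => u (m + n)%N) (c := c) (D_cvg_subseq shift_inc ff).
- by have [] := usol (m + n)%N.
- have [_ umin] := usol (m + n)%N.
  by apply: le_lt_trans (umin _ u0dom) _; apply: Jm => /=; exact: leq_addr.
- exists (fun n => m + phi n)%N, v; split=> // x y.
  by rewrite -phi_inc; exact: leq_add2l.
Qed.

End Stability.

Theorem corollary2p7 (K : numFieldType) (R : realType)
    (X : completeNormedModType K) (N : nat) (Y : 'I_N -> normedModType K)
    (Reg : X -> \bar R) (D : forall i, Y i -> Y i -> \bar R)
    (domT : 'I_N -> set X) (T : forall i, X -> Y i)
    (tauX : topology_on X) (tauY tauD : forall i, topology_on (Y i))
    (Reg_ge0 : forall u, 0 <= Reg u)
    (D_ge0 : forall i (a b : Y i), 0 <= D i a b)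
    (tauX_hausdorff : hausdorff_space (with_topology tauX))
    (tauY_hausdorff : forall i, hausdorff_space (with_topology (tauY i)))
    (HG : assumption_G Reg D domT T tauX tauY tauD)
    (f : nat -> forall i, Y i) (fdag : forall i, Y i)
    (f_cvg : D_cvg D tauD f fdag)
    (lambda : 'I_N -> R) (lambda_gt0 : forall i, (0 < lambda i)%R)
    (u0 : X) (u0_sol : solution Reg D domT T lambda fdag u0)
    (u0_fin : J Reg D T lambda u0 fdag < +oo)
    (u0_S1 : S1 D T tauD u0 fdag setT) :
  forall u : nat -> X,
    (forall n, solution Reg D domT T lambda (f n) (u n)) ->
    (exists (phi : nat -> nat) (udag : X),
      [/\ increasing_seq phi,
          cvg_in tauX (fun n => u (phi n)) udag,
          forall i, D i (T i (u (phi n))) (f (phi n) i) @[n --> \oo]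
                    --> D i (T i udag) (fdag i)
        & Reg (u (phi n)) @[n --> \oo] --> Reg udag]) /\
    (forall (phi : nat -> nat) (v : X),
      increasing_seq phi -> cvg_in tauX (fun n => u (phi n)) v ->
      solution Reg D domT T lambda fdag v).
Proof.
move=> u usol; have [u0dom _] := u0_sol.
have limit phi v : increasing_seq phi -> cvg_in tauX (fun n => u (phi n)) v ->
    _ := fun phi_inc => cvg_solutions Reg_ge0 D_ge0 lambda_gt0 HG u0_sol u0_fin
      u0_S1 (D_cvg_subseq phi_inc f_cvg) (fun n => usol (phi n)).
split=> [|phi v phi_inc uv]; last by have [] := limit phi v phi_inc uv.
have [phi [v [phi_inc uv]]] := solutions_cvg_subseq Reg_ge0 D_ge0 lambda_gt0
  HG u0dom u0_fin u0_S1 f_cvg usol.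
by exists phi, v; have [] := limit phi v phi_inc uv.
Qed.
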